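(* Assume the Riemann hypothesis. Let $(X_p)_{p\in\mathcal P}$ be independent symmetric non-constant real random variables with $M:=\sup_{p\in\mathcal P}\|X_p\|_{L^\infty}<\infty$, and let $S_n=\sum_{\ell=1}^n\theta_\ell$ be the partial sums of the associated random multiplicative function of Rademacher type. Let $M_n=\max(M,1)^{\frac{c\ln n}{\ln\ln n}}$, where $c$ is any constant such that $\omega(\ell)\le \frac{c\ln \ell}{\ln\ln \ell}$ for all $\ell$ large enough. Then there is an absolute constant $C>0$ such that for every $q\ge 2$ and every integer $n\geq 3$, $$\|S_n\|_{L^q}\le C\sqrt q\, M_n\, n^{1-\frac{1}{2(1+\sqrt{\ln n})}}.$$
   Context: $\mathcal P$ is the set of prime numbers; $\omega(\ell)$ is the number of distinct prime factors of $\ell$. The random variables $X_p$ need not be identically distributed. The random multiplicative function of Rademacher type generated by $(X_p)$ is $\theta_\ell=\prod_{p\mid \ell}X_p$ if $\ell$ is square free (so $\theta_1=1$, empty product), and $\theta_\ell=0$ otherwise.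
   Formalization: An absolute C valid for all n ≥ 3 and every eventually admissible c is false (c = 1.1, n = 223092870, X_p = ±M, M → ∞); here C is absolute for n ≥ n0(c), and for 3 ≤ n < n0(c) it is replaced by a constant K depending only on c and M. *)

(* Defs.v *)
From HB Require Import structures.
From mathcomp Require Import all_boot all_order all_algebra.
From mathcomp Require Import all_classical all_reals all_analysis.
From mathcomp.real_closed Require Import complex.

Set Implicit Arguments.
Unset Strict Implicit.
Unset Printing Implicit Defensive.

Import Order.TTheory GRing.Theory Num.Theory.
Import numFieldNormedType.Exports.

Local Open Scope classical_set_scope.
Local Open Scope ring_scope.

(* n ^ (- s) = exp (- s * ln n), for n > 0. *)
Definition natpowN (R : realType) (n : nat) (s : R[i]) : R[i] :=
  let a : R := n%:R `^ (- complex.Re s) in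
  let t : R := complex.Im s * ln n%:R in
  Complex (a * cos t) (- (a * sin t)).

(* Complex differentiability is derivability over the scalar field R[i].
   C \ {1} is connected, so these two conditions determine zeta on it. *)
Definition is_riemann_zeta (R : realType) (zeta : R[i]^o -> R[i]^o) : Prop :=
  (forall s : R[i]^o, s != 1 -> derivable zeta s 1) /\
  (forall s : R[i]^o, 1 < complex.Re s ->
    series (fun k : nat => natpowN k.+1 s : R[i]^o) @ \oo --> zeta s).

Definition riemann_hypothesis (R : realType) : Prop :=
  forall zeta : R[i]^o -> R[i]^o, is_riemann_zeta zeta ->
  forall s : R[i]^o, s != 1 -> zeta s = 0 ->
    (forall k : nat, s != - (k.+1.*2)%:R) ->
    complex.Re s = 2^-1.

Definition omega (l : nat) : nat := size (primes l).

Definition square_free (l : nat) : bool :=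
  (0 < l)%N && all (fun p => ~~ (p ^ 2 %| l)%N) (primes l).

(* Every c > 1 qualifies, but for c close to 1 the inequality fails at some small
   l: at l = 223092870, where omega l = 9, it needs c > 1.38. Since theta_l may
   have size M ^ omega l, no constant independent of M and c bounds
   ||S_n||_q / (sqrt q * M_n * ...) at such small n; hence the threshold n0 and
   the second constant K in the theorem. *)
Definition omega_bound (R : realType) (c : R) : Prop :=
  exists L : nat, forall l : nat, (L <= l)%N ->
    (omega l)%:R <= c * ln l%:R / ln (ln l%:R).

(* Families (X_p) indexed by the primes are encoded as families indexed by nat
   of which only the members with prime index are constrained or used. *)
Section random_multiplicative.
Context (d : measure_display) (T : measurableType d) (R : realType)
  (P : probability T R).
Implicit Type X : nat -> {RV P >-> R}.

Definition prime_independent X : Prop :=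
  forall (J : seq nat) (A : nat -> set R),
    uniq J -> all prime J -> (forall p, p \in J -> measurable (A p)) ->
    P (\bigcap_(p in [set` J]) (X p @^-1` A p)) =
    (\prod_(p <- J) P (X p @^-1` A p))%E.

Definition symmetric_rv (Y : {RV P >-> R}) : Prop :=
  forall A : set R, measurable A ->
    P (Y @^-1` A) = P ((fun w => - Y w) @^-1` A).

Definition nonconstant_rv (Y : {RV P >-> R}) : Prop :=
  ~ exists a : R, {ae P, forall w, Y w = a}.

Definition sup_Linfty X : \bar R :=
  ereal_sup [set ('N[P]_+oo[EFin \o X p])%E | p in [set p | prime p]].

Definition theta X (l : nat) (w : T) : R :=
  if square_free l then \prod_(p <- primes l) X p w else 0.

Definition partial_sum X (n : nat) (w : T) : R :=
  \sum_(1 <= l < n.+1) theta X l w.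

End random_multiplicative.

Definition Mseq (R : realType) (M c : R) (n : nat) : R :=
  Num.max M 1 `^ (c * ln n%:R / ln (ln n%:R)).

(* Main.v *)
(** Order the square free [l <= n] by their largest prime factor [k]. The sum of
    the [theta_l] in the [k]-th layer is [X_k] times a function of the [X_p] with
    [p < k], and the law of the sample is invariant under flipping the sign of
    [X_k], so the layers behave like bounded martingale differences: averaging
    over the signs one layer at a time bounds the exponential moments of [S_n],
    hence [||S_n||_q <= 2 e^2 sqrt q * sqrt (sum_k b_k^2)], where [b_k] is an
    almost sure bound for the [k]-th layer. Here [b_k] is [M_n] times the number
    of integers in the layer. With [s = sqrt (ln n)], a layer [k > e^s] has at
    most [n / k] elements, and a layer [k <= e^s] contains only [e^s]-smooth
    integers, which Rankin's trick with exponent [1 - 2 / s] shows to be at most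
    [n e^(- s)] in number; the sum of the squares is therefore [O(n^2 e^(- s))].
    Rankin's trick needs [sum_(p <= y) 1 / p = o(ln y)], which follows from the
    bound on [omega] by double counting the pairs [p %| l <= y]. *)

Require Import Defs.
From HB Require Import structures.
From mathcomp Require Import all_boot all_order all_algebra.
From mathcomp Require Import all_classical all_reals all_analysis.
From mathcomp Require Import measurable_realfun ess_sup_inf.
From mathcomp Require Import zify ring lra.

Import Order.TTheory GRing.Theory Num.Theory.
Import numFieldNormedType.Exports.

Local Open Scope classical_set_scope.
Local Open Scope ring_scope.

Set Implicit Arguments.
Unset Strict Implicit.
Unset Printing Implicit Defensive.

(** * Layers by largest prime factor, and counts of smooth integers *)

Section smooth_sums.
Context {R : realType}.
Implicit Types (x : nat -> R) (n k N : nat).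

(** With the strict inequality, [smooth k.+1] exceeds [smooth k] exactly by [layer k], which is
    empty unless [k] is prime. *)
Definition smooth k (l : nat) := all (fun p => p < k)%N (primes l).

(** This is [theta] as a function of a deterministic sequence, so that a sign change can act on the
    sequence instead of the probability space. *)
Definition mulfun x (l : nat) : R :=
  if square_free l then \prod_(p <- primes l) x p else 0.

Definition smooth_sum n k x : R :=
  \sum_(1 <= l < n.+1 | smooth k l) mulfun x l.

Definition layer k (l : nat) := smooth k.+1 l && (k \in primes l).

Definition layer_sum n k x : R :=
  \sum_(1 <= l < n.+1 | layer k l) mulfun x l.

Definition layer_count n k : nat :=
  \sum_(1 <= l < n.+1 | layer k l && square_free l) 1.

Definition smooth_count n k : nat :=
  \sum_(1 <= l < n.+1 | smooth k l && square_free l) 1.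

Definition flip k x : nat -> R := fun p => if p == k then - x p else x p.

Lemma smooth_smoothS k l : smooth k l = smooth k.+1 l && (k \notin primes l).
Proof.
apply/allP/andP => [sm|[/allP sm kl] p pl].
  split; last by apply/negP => /sm; rewrite ltnn.
  by apply/allP => p /sm /ltnW.
have := sm p pl; rewrite ltnS leq_eqVlt => /orP[/eqP pk|//].
by rewrite -pk pl in kl.
Qed.

Lemma smooth_sumS n k x :
  smooth_sum n k.+1 x = smooth_sum n k x + layer_sum n k x.
Proof.
rewrite /smooth_sum (bigID (fun l => k \in primes l))/= addrC; congr (_ + _).
by apply: eq_bigl => l; rewrite -smooth_smoothS.
Qed.

Lemma smooth_sum0 n x : (0 < n)%N -> smooth_sum n 0 x = 1.
Proof.
move=> n0; rewrite /smooth_sum big_ltn_cond//= big1_seq ?addr0.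
  by rewrite /mulfun /square_free /= big_nil.
move=> l /andP[sm]; rewrite mem_index_iota => /andP[l1 _].
have := allP sm (pdiv l); rewrite ltn0 mem_primes pdiv_prime// pdiv_dvd.
by rewrite (ltn_trans _ l1)//= => /(_ isT).
Qed.

Lemma smooth_sum_top n x :
  smooth_sum n n.+1 x = \sum_(1 <= l < n.+1) mulfun x l.
Proof.
rewrite /smooth_sum big_nat_cond [RHS]big_nat_cond; apply: eq_bigl => l.
case: (boolP (0 < l < n.+1)%N) => //= /andP[l0 ln].
apply/allP => p; rewrite mem_primes => /and3P[_ _ pl].
by rewrite (leq_ltn_trans _ ln)// dvdn_leq.
Qed.

Lemma mulfun_flip_id k x l : k \notin primes l -> mulfun (flip k x) l = mulfun x l.
Proof.
move=> kl; rewrite /mulfun; case: ifP => // _; apply: eq_big_seq => p pl.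
by rewrite /flip; case: eqP => // pk; rewrite -pk pl in kl.
Qed.

Lemma mulfun_flipN k x l : k \in primes l -> mulfun (flip k x) l = - mulfun x l.
Proof.
move=> kl; rewrite /mulfun; case: ifP => [_|]; last by rewrite oppr0.
rewrite (bigD1_seq k)//= ?primes_uniq// [in RHS](bigD1_seq k)//= ?primes_uniq//.
rewrite {1}/flip eqxx mulNr; congr (- (_ * _)).
by apply: eq_bigr => p /negbTE pk; rewrite /flip pk.
Qed.

Lemma smooth_sum_flip n k x : smooth_sum n k (flip k x) = smooth_sum n k x.
Proof.
apply: eq_bigr => l; rewrite smooth_smoothS => /andP[_].
exact: mulfun_flip_id.
Qed.

(** Each nonzero term carries the factor [x k] exactly once, since [l] is square free. *)
Lemma layer_sum_flip n k x : layer_sum n k (flip k x) = - layer_sum n k x.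
Proof. by rewrite -sumrN; apply: eq_bigr => l /andP[_]; exact: mulfun_flipN. Qed.

Lemma norm_layer_sum n k x (m A : R) :
  (forall p, prime p -> `|x p| <= m) ->
  (forall l, (0 < l <= n)%N -> m ^+ omega l <= A) ->
  `|layer_sum n k x| <= A * (layer_count n k)%:R.
Proof.
move=> xm mA; rewrite natr_sum mulr_sumr.
rewrite (le_trans (ler_norm_sum _ _ _))//.
rewrite [leRHS]big_mkcondr/= big_nat_cond [leRHS]big_nat_cond.
apply: ler_sum => l /andP[ln _]; rewrite /mulfun mulr1.
case: ifP => _; last by rewrite normr0.
rewrite normr_prod (le_trans _ (mA l ln))//.
rewrite /omega -count_predT -iter_mulr_1 -big_const_seq.
rewrite big_seq [leRHS]big_seq.
apply: ler_prod => p; rewrite mem_primes => /andP[pp _].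
by rewrite normr_ge0 xm.
Qed.

(** All members of the layer are multiples of [k]. *)
Lemma layer_count_le_div n k : (layer_count n k <= n %/ k)%N.
Proof.
rewrite divn_count_dvd /layer_count big_mkcond/=; apply: leq_sum => l _.
case: ifP => // /andP[/andP[_]]; rewrite mem_primes => /and3P[_ _ ->] //.
Qed.

Lemma layer_count_le_smooth n k N :
  (k < N)%N -> (layer_count n k <= smooth_count n N)%N.
Proof.
move=> kN; rewrite /layer_count /smooth_count.
rewrite big_mkcond [leqRHS]big_mkcond/=; apply: leq_sum => l _.
case: ifP => // /andP[/andP[sm _] sf]; rewrite sf andbT.
suff -> : smooth N l by [].
by apply/allP => p /(allP sm); rewrite ltnS => /leq_ltn_trans; apply.
Qed.

Lemma square_free_prod l : square_free l -> (\prod_(p <- primes l) p)%N = l.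
Proof.
case/andP=> l0 /allP sf; rewrite [RHS]prod_prime_decomp// prime_decompE big_map/=.
apply: eq_big_seq => p pl; have := sf p pl; rewrite pfactor_dvdn//; last first.
  by move: pl; rewrite mem_primes => /andP[].
rewrite -ltnNge ltnS; move: pl; rewrite -logn_gt0.
by case: (logn p l) => [|[]].
Qed.

(* Rankin's trick: [1 <= (n / l) ^ sigma] on the range of summation, and the
   sum of [l ^ - sigma] over square free smooth [l] is a sub-sum of the expanded
   Euler product. *)
Lemma smooth_count_rankin n N (sigma : R) : 0 <= sigma ->
  (smooth_count n N)%:R <=
  n%:R `^ sigma * \prod_(i < N) (1 + (prime i)%:R * i%:R `^ (- sigma)).
Proof.
move=> sg0.
pose a (i : 'I_N) : R := (prime i)%:R * i%:R `^ (- sigma).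
have a0 i : 0 <= a i by rewrite mulr_ge0 ?powR_ge0.
(* An integer of [D] is encoded by its set of prime factors, a subset of ['I_N] by smoothness; being
   square free, it is the product of that set, so the encoding is injective. *)
pose h (l : 'I_n.+1) := [set i : 'I_N | val i \in primes l]%SET.
pose D := [set l : 'I_n.+1 | [&& (0 < l)%N, smooth N l & square_free l]]%SET.
have h_perm (l : 'I_n.+1) : l \in D -> perm_eq [seq val i | i <- enum (h l)] (primes l).
  rewrite inE => /and3P[_ /allP sm _]; apply: uniq_perm => [||p].
  - by rewrite map_inj_uniq ?enum_uniq//; exact: val_inj.
  - exact: primes_uniq.
  apply/mapP/idP => [[i]|pl]; first by rewrite mem_enum inE => il ->.
  by exists (Ordinal (sm p pl)) => //; rewrite mem_enum inE.
have h_inj : {in D &, injective h}.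
  move=> l1 l2 D1 D2 h12; apply: val_inj => /=.
  have /square_free_prod <- : square_free l1 by move: D1; rewrite inE => /and3P[].
  have /square_free_prod <- : square_free l2 by move: D2; rewrite inE => /and3P[].
  by rewrite -(perm_big _ (h_perm _ D1))/= -(perm_big _ (h_perm _ D2))/= h12.
have -> : (smooth_count n N)%:R = \sum_(l in D) 1 :> R.
  rewrite natr_sum (big_addn 0) big_mkord.
  rewrite [RHS](eq_bigl (fun l : 'I_n.+1 => (0 < l)%N && (smooth N l && square_free l)));
    last by move=> l; rewrite inE.
  by rewrite big_mkcond [RHS]big_mkcond big_ord_recl/= add0r subn1/=;
    apply: eq_bigr => i _; rewrite addn1.
(* The Euler product expands into a sum over all subsets of ['I_N]. *)
rewrite (eq_bigr (fun i => a i + 1)) ?bigA_distr; last by move=> i _; rewrite addrC.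
have aE (l : 'I_n.+1) : l \in D -> \prod_(i in h l) a i = (val l)%:R `^ (- sigma).
  move=> lD; have := lD; rewrite inE => /and3P[_ _ /square_free_prod lE].
  transitivity (\prod_(p <- primes l) (p%:R `^ (- sigma)) : R).
    rewrite -(perm_big _ (h_perm l lD))/= big_map big_enum/=.
    apply: eq_bigr => i; rewrite inE mem_primes /a => /andP[-> _].
    by rewrite mul1r.
  transitivity ((\prod_(p <- primes l) p)%N%:R `^ (- sigma) : R); last by rewrite lE.
  rewrite natr_prod.
  elim: (primes l) => [|p s IH]; first by rewrite !big_nil powR1.
  by rewrite !big_cons IH powRM// prodr_ge0.
have le_sum : \sum_(l in D) (val l)%:R `^ (- sigma) <=
    \sum_(J in {set 'I_N}) \prod_i (if i \in J then a i else 1) :> R.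
  rewrite (eq_bigr (fun l => \prod_(i in h l) a i)); last by move=> l /aE ->.
  rewrite -(big_imset (fun J : {set 'I_N} => \prod_(i in J) a i) h_inj)/=.
  rewrite big_mkcond/=; apply: ler_sum => J _; rewrite -big_mkcond/=.
  by case: ifP => // _; exact: prodr_ge0.
apply: le_trans (ler_wpM2l (powR_ge0 _ _) le_sum).
rewrite mulr_sumr; apply: ler_sum => l; rewrite inE => /andP[l0 _].
rewrite powRN ler_pdivlMr ?powR_gt0 ?ltr0n// mul1r.
by rewrite ge0_ler_powR ?nnegrE// ler_nat -ltnS ltn_ord.
Qed.

(* Each prime [p <= N] divides [N %/ p >= N / (2 p)] of the integers [1, ..., N]. *)
Lemma sum_inv_primes_le N (W : R) : (0 < N)%N ->
  (forall l, (0 < l <= N)%N -> (omega l)%:R <= W) ->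
  \sum_(p < N.+1) (prime p)%:R / p%:R <= 2 * W.
Proof.
move=> N0 oW.
have omegaE l : (0 < l <= N)%N ->
    omega l = (\sum_(p < N.+1) prime p * (p %| l))%N.
  move=> /andP[l0 lN]; rewrite /omega -sum1_size.
  rewrite -(big_mkord predT (fun p => prime p * (p %| l))%N).
  rewrite [RHS](eq_bigr (fun p => if p \in primes l then 1%N else 0%N)); last first.
    by move=> p _; rewrite mem_primes l0; case: prime; case: (p %| l)%N.
  rewrite -big_mkcond/= -[RHS]big_filter; apply: perm_big.
  apply: uniq_perm; rewrite ?primes_uniq ?filter_uniq ?iota_uniq// => p.
  rewrite mem_filter mem_index_iota/=; case: (boolP (p \in _)) => //=.
  by rewrite mem_primes ltnS => /and3P[_ _ /dvdn_leq] /(_ l0) /leq_trans ->.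
have Np : 0 < N%:R :> R by rewrite ltr0n.
have step (p : 'I_N.+1) : N%:R * ((prime p)%:R / p%:R) <=
    2 * \sum_(1 <= l < N.+1) (prime p * (p %| l))%N%:R :> R.
  rewrite -natr_sum -big_distrr/= -divn_count_dvd.
  case: (boolP (prime p)) => [pp|]; last by rewrite mul0r mulr0 mul0n mulr0.
  have p0 : 0 < p%:R :> R by rewrite ltr0n prime_gt0.
  rewrite mul1n div1r ler_pdivrMr// -natrM -natrM ler_nat.
  have := ltn_ord p; have := divn_eq N p; have := ltn_pmod N (prime_gt0 pp).
  (* As [t >= 1], one has [N = t p + r < (t + 1) p <= 2 t p]. *)
  have : (0 < N %/ p)%N by rewrite divn_gt0 ?prime_gt0// -ltnS.
  set t := (N %/ p)%N; set r := (N %% p)%N; move=> t0 rp NE _; nia.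
rewrite -(ler_pM2l Np) mulr_sumr; apply: (le_trans (ler_sum _ (fun p _ => step p))).
rewrite -mulr_sumr mulrCA ler_pM2l// exchange_big/=.
rewrite (_ : N%:R * W = \sum_(1 <= l < N.+1) W); last first.
  by rewrite big_const_nat iter_addr_0 subn1 mulr_natl.
rewrite big_nat_cond [leRHS]big_nat_cond; apply: ler_sum => l /andP[lN _].
by rewrite -natr_sum -omegaE ?oW.
Qed.
End smooth_sums.

(** * Invariance of the law of the sample under a sign flip *)

Section sign_flip.
Context {R : realType}.
Implicit Types (J : seq nat) (x : nat -> R).

Definition rect J (A : nat -> set R) : set (nat -> R) :=
  \bigcap_(p in [set` J]) ((fun x => x p) @^-1` A p).

(** Only the finitely many coordinates in [J] are constrained, because independence is stated for
    finite families of primes. *)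
Definition rects J : set (set (nat -> R)) :=
  [set rect J A | A in [set A | forall p, measurable (A p)]].

Definition coord_space J := g_sigma_algebraType (rects J).

Lemma setI_closed_rects J : setI_closed (rects J).
Proof.
move=> _ _ [A mA <-] [B mB <-]; exists (fun p => A p `&` B p) => /=.
  by move=> p; exact: measurableI.
rewrite /rect -bigcapI; apply: eq_bigcapr => p _; exact: preimage_setI.
Qed.

Lemma measurable_coord J p : p \in J ->
  measurable_fun [set: coord_space J] (fun x : coord_space J => x p).
Proof.
move=> pJ _ B mB; rewrite setTI; apply: sub_sigma_algebra.
exists (fun r => if r == p then B else setT) => /=.
  by move=> r; case: ifP.
apply/seteqP; split => [x /(_ p pJ)/=|x Bx r _ /=]; first by rewrite eqxx.
by case: eqP => // ->.
Qed.

Lemma measurable_to_coord J d (T : measurableType d) (Z : nat -> T -> R) :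
  (forall p, measurable_fun setT (Z p)) ->
  measurable_fun setT ((fun w p => Z p w) : T -> coord_space J).
Proof.
move=> mZ; apply: (@measurability _ _ T (coord_space J) _ _ (rects J)) => //.
move=> _ [_ [A mA <-] <-]; rewrite setTI /rect preimage_bigcap.
apply: bigcap_measurableType => p _; rewrite -(setTI (_ @^-1` _)).
exact: mZ.
Qed.

Context d (T : measurableType d) (P : probability T R)
  (X : nat -> {RV P >-> R}).
Hypothesis indX : prime_independent X.
Hypothesis symX : forall p, prime p -> symmetric_rv (X p).

Definition sample (w : T) : nat -> R := fun p => X p w.

Lemma measurable_flip_coord k p : measurable_fun setT (fun w => flip k (sample w) p).
Proof.
rewrite /flip; case: eqP => _; last exact: measurable_funPT.
by apply: measurable_funN; exact: measurable_funPT.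
Qed.

(** The preimage of a rectangle under the flip is the rectangle whose [k]-th side is reflected. Both
    probabilities factor by independence, and the [k]-th factors agree by symmetry of [X k]. *)
Lemma prob_rect_flip J k (A : nat -> set R) : uniq J -> all prime J ->
  (forall p, measurable (A p)) ->
  P ((fun w => flip k (sample w)) @^-1` rect J A) = P (sample @^-1` rect J A).
Proof.
move=> uJ pJ mA.
pose A' p := if p == k then -%R @^-1` A p else A p.
have mA' p : measurable (A' p).
  rewrite /A'; case: ifP => // _; rewrite -(setTI (_ @^-1` _)).
  exact: oppr_measurable.
have -> : (fun w => flip k (sample w)) @^-1` rect J A = sample @^-1` rect J A'.
  apply/seteqP; split => w /= + p pJ' => /(_ p pJ');
    by rewrite /A' /flip /=; case: ifP.
rewrite /rect !preimage_bigcap.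
rewrite (indX uJ pJ (fun p _ => mA' p)) (indX uJ pJ (fun p _ => mA p)).
rewrite big_seq [RHS]big_seq.
apply: eq_bigr => p /(allP pJ) pp; rewrite /A'; case: ifP => // _.
by rewrite (symX pp (mA p)).
Qed.

(** Both sides integrate [f] against a pushforward of [P] to the sequence space, and these two laws
    coincide. *)
Lemma integral_flip J k (f : (nat -> R) -> \bar R) : uniq J -> all prime J ->
  measurable_fun [set: coord_space J] f -> (forall x, 0 <= f x)%E ->
  (\int[P]_w f (flip k (sample w)) = \int[P]_w f (sample w))%E.
Proof.
move=> uJ pJ mf f0.
pose h1 : T -> coord_space J := fun w => flip k (sample w).
pose h2 : T -> coord_space J := sample.
have m1 : measurable_fun setT h1.
  exact: measurable_to_coord (measurable_flip_coord k).
have m2 : measurable_fun setT h2.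
  by apply: measurable_to_coord => p; exact: measurable_funPT.
pose g1 : {mfun T >-> coord_space J} :=
  HB.pack h1 (isMeasurableFun.Build _ _ _ _ h1 m1).
pose g2 : {mfun T >-> coord_space J} :=
  HB.pack h2 (isMeasurableFun.Build _ _ _ _ h2 m2).
transitivity (\int[pushforward P g1]_y f y)%E.
  by rewrite (ge0_integral_pushforward m1).
transitivity (\int[pushforward P g2]_y f y)%E; last first.
  by rewrite (ge0_integral_pushforward m2).
apply: eq_measure_integral => E mE _.
(* Rectangles form a generating pi-system, so agreement on them suffices; the constant sequence
   [setT] is the exhaustion by sets of finite measure. *)
apply: (@g_sigma_algebra_measure_unique _ R (coord_space J) (rects J) _
  (fun=> setT)) => //.
- by move=> ? ?; exact: sub_sigma_algebra.
- by move=> _; exists (fun=> setT) => //; apply/seteqP; split.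
- by rewrite bigcup_const//; exists 0%N.
- exact: setI_closed_rects.
- by move=> _ [A mA <-]; exact: prob_rect_flip.
- by move=> _; change (P setT < +oo)%E; rewrite probability_setT ltry.
Qed.

End sign_flip.

(** * Elementary inequalities for the exponential *)

Section exp_inequalities.
Context {R : realType}.
Implicit Types u x lam q : R.

(** From [expR (- u) >= 1 - u] comes [(1 - u) * expR u <= 1], while [(1 - u) (1 + u + 2 u^2) = 1 +
    u^2 (1 - 2 u) >= 1]. *)
Lemma expR_le_quad u : `|u| <= 2^-1 -> expR u <= 1 + u + 2 * u ^+ 2.
Proof.
rewrite ler_norml => /andP[u1 u2].
have := expR_ge1Dx (- u); rewrite expRN => h.
have e0 := expR_gt0 u.
have h1 : (1 - u) * expR u <= 1 by rewrite -ler_pdivlMr// div1r.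
have : 1 <= (1 - u) * (1 + u + 2 * u ^+ 2) by nra.
move=> /(le_trans h1); rewrite ler_pM2l//; lra.
Qed.

(** For small [u] the linear terms of the quadratic bounds cancel; for [|u| > 1/2] already
    [|u| <= 2 u^2]. The constant 2 is not sharp. *)
Lemma cosh_le u : 2^-1 * expR u + 2^-1 * expR (- u) <= expR (2 * u ^+ 2).
Proof.
have [u_le|u_gt] := leP `|u| 2^-1.
  have h1 := expR_le_quad u_le; have := u_le; rewrite -normrN => /expR_le_quad.
  have := expR_ge1Dx (2 * u ^+ 2); rewrite sqrrN; lra.
have h v : v <= `|u| -> expR v <= expR (2 * u ^+ 2).
  move=> vu; rewrite ler_expR (le_trans vu)// -real_normK ?num_real//; nra.
have := h u (ler_norm _); have := h (- u); rewrite -normrN => /(_ (ler_norm _)).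
lra.
Qed.

Lemma cosh_step lam u v b : `|v| <= b ->
  2^-1 * expR (lam * (u + v)) + 2^-1 * expR (lam * (u - v)) <=
  expR (2 * (lam * b) ^+ 2) * expR (lam * u).
Proof.
move=> vb; rewrite mulrDr mulrBr !expRD [expR (lam * u) * _]mulrC.
rewrite [expR (lam * u) * _]mulrC !mulrA -mulrDl ler_wpM2r ?expR_ge0//.
apply: (le_trans (cosh_le _)); rewrite ler_expR !exprMn.
have v2 : v ^+ 2 <= b ^+ 2.
  by rewrite -(real_normK (num_real v)) lerXn2r ?nnegrE// (le_trans _ vb).
by have := ler_wpM2l (sqr_ge0 lam) v2; lra.
Qed.

(** Apply [y <= expR (y - 1)] to [y = lam |x| / q] and raise to the power [q]; the sum of the two
    exponentials dominates [expR (lam |x|)]. *)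
Lemma powR_le_expR x lam q : 0 < lam -> 0 < q ->
  `|x| `^ q <= (q / (expR 1 * lam)) `^ q * (expR (lam * x) + expR (- lam * x)).
Proof.
move=> l0 q0.
have e0 : 0 < q / (expR 1 * lam) by rewrite divr_gt0// mulr_gt0// expR_gt0.
have e1 := lt0r_neq0 (expR_gt0 (1 : R)).
have h : `|x| <= q / (expR 1 * lam) * expR (lam * `|x| / q).
  have := expR_ge1Dx (lam * `|x| / q - 1); rewrite addrC subrK expRB => h.
  have -> : q / (expR 1 * lam) * expR (lam * `|x| / q) =
      q / lam * (expR (lam * `|x| / q) / expR 1).
    by field; rewrite e1 lt0r_neq0.
  have := ler_wpM2l (ltW (divr_gt0 q0 l0)) h; apply: le_trans.
  by rewrite le_eqVlt; apply/orP; left; apply/eqP; field; rewrite !lt0r_neq0.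
apply: (le_trans (ge0_ler_powR (ltW q0) _ _ h)).
- by rewrite nnegrE.
- by rewrite nnegrE mulr_ge0 ?expR_ge0// ltW.
rewrite powRM ?expR_ge0//; last exact: ltW.
rewrite ler_wpM2l ?powR_ge0// -expRM divfK ?lt0r_neq0//.
have [x0|x0] := leP 0 x; first by rewrite ger0_norm// lerDl expR_ge0.
by rewrite ltr0_norm// mulrN mulNr lerDr expR_ge0.
Qed.

End exp_inequalities.

(** * From exponential moments to the L^q norm *)

Section moments.
Context {R : realType} d (T : measurableType d) (P : probability T R)
  (X : nat -> {RV P >-> R}).
Hypothesis indX : prime_independent X.
Hypothesis symX : forall p, prime p -> symmetric_rv (X p).
Local Notation sample := (sample X).

Definition primes_upto n := [seq p <- iota 0 n.+1 | prime p].

(** Measurability on the sequence space is what [integral_flip] asks for; the prime factors of any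
    [l <= n] lie in [primes_upto n]. *)
Lemma measurable_smooth_sum n k :
  measurable_fun [set: coord_space (R := R) (primes_upto n)] (smooth_sum n k).
Proof.
(* The range is moved into the summand, since each term needs [l <= n] to be measurable for the
   coordinates in [primes_upto n]. *)
rewrite (_ : smooth_sum n k = fun x => \sum_(1 <= l < n.+1)
  if (1 <= l < n.+1)%N && smooth k l then mulfun x l else 0); last first.
  by apply/funext => x; rewrite /smooth_sum big_nat_cond big_mkcond.
apply: measurable_sum => l /=; case: (boolP (_ && _)) => [/andP[/andP[l0 ln] _]|_];
  last exact: measurable_cst.
rewrite /mulfun; case: (square_free l); last exact: measurable_cst.
apply: measurable_prod => p; rewrite mem_primes => /and3P[pp _ pl].
apply: measurable_coord; rewrite mem_filter pp mem_iota/= add0n.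
by rewrite (leq_ltn_trans _ ln)// dvdn_leq.
Qed.

Lemma measurable_smooth_sum_sample n k :
  measurable_fun setT (fun w => smooth_sum n k (sample w)).
Proof.
rewrite /smooth_sum; under eq_fun do rewrite big_mkcond.
apply: measurable_sum => l; case: (smooth k l); last exact: measurable_cst.
rewrite /mulfun; case: (square_free l); last exact: measurable_cst.
by apply: measurable_prod => p _; exact: measurable_funPT.
Qed.

(** The integrand is nonnegative, so the value in [\bar R] makes sense before any integrability is
    known. *)
Definition mgf n k (lam : R) : \bar R :=
  (\int[P]_w (expR (lam * smooth_sum n k (sample w)))%:E)%E.

Let mexp n k (lam : R) :
  measurable_fun setT (fun w => expR (lam * smooth_sum n k (sample w))).
Proof.
apply: measurableT_comp; first exact: measurable_expR.
apply: measurable_funM; first exact: measurable_cst.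
exact: measurable_smooth_sum_sample.
Qed.

Let mexpE n k (lam : R) :
  measurable_fun setT (fun w => (expR (lam * smooth_sum n k (sample w)))%:E).
Proof. by apply/measurable_EFinP; exact: mexp. Qed.

Let expE_ge0 n k (lam : R) w : setT w ->
  (0 <= (expR (lam * smooth_sum n k (sample w)))%:E)%E.
Proof. by rewrite lee_fin expR_ge0. Qed.

Let mexpM n k (lam a : R) :
  measurable_fun setT (fun w => (a * expR (lam * smooth_sum n k (sample w)))%:E).
Proof.
apply/measurable_EFinP; apply: measurable_funM; first exact: measurable_cst.
exact: mexp.
Qed.

(* Averaging over the sign of [X k], which does not change the law of the
   sample, replaces [exp (lam * layer)] by [cosh (lam * layer)]. *)
Lemma mgf_step n k (lam b : R) :
  {ae P, forall w, `|layer_sum n k (sample w)| <= b} ->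
  (mgf n k.+1 lam <= (expR (2 * (lam * b) ^+ 2))%:E * mgf n k lam)%E.
Proof.
move=> layer_le.
(* The factor 1/2 makes the integral of [g] at the sample plus [g] at the flipped sample equal to
   the original one. *)
pose g x : \bar R := (2^-1 * expR (lam * smooth_sum n k.+1 x))%:E.
have g0 x : (0 <= g x)%E by rewrite lee_fin mulr_ge0 ?invr_ge0 ?expR_ge0.
have mg : measurable_fun [set: coord_space (primes_upto n)] g.
  apply/measurable_EFinP; apply: measurable_funM; first exact: measurable_cst.
  apply: measurableT_comp => //; apply: measurable_funM; first exact: measurable_cst.
  exact: measurable_smooth_sum.
have uJ : uniq (primes_upto n) by rewrite filter_uniq ?iota_uniq.
have pJ : all prime (primes_upto n) by exact: filter_all.
have flipE := integral_flip indX symX k uJ pJ mg g0.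
have mgs : measurable_fun setT (fun w => g (sample w)) by exact: mexpM.
have gfE w : g (flip k (sample w)) =
    (2^-1 * expR (lam * (smooth_sum n k (sample w) - layer_sum n k (sample w))))%:E.
  by rewrite /g smooth_sumS smooth_sum_flip layer_sum_flip.
have mgf' : measurable_fun setT (fun w => g (flip k (sample w))).
  (* The smooth sum minus the layer is twice [smooth_sum n k] minus [smooth_sum n k.+1], which gives
     a product of two exponentials already known to be measurable. *)
  have -> : (fun w => g (flip k (sample w))) = (fun w => (2^-1 * (
      expR (lam *+ 2 * smooth_sum n k (sample w)) *
      expR (- lam * smooth_sum n k.+1 (sample w))))%:E).
    apply/funext => w; rewrite gfE smooth_sumS -expRD; congr (_ * expR _)%:E.
    ring.
  apply/measurable_EFinP; apply: measurable_funM; first exact: measurable_cst.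
  by apply: measurable_funM; exact: mexp.
have e0 (a mu : R) m w : 0 <= a ->
    (0 <= (a * expR (mu * smooth_sum n m (sample w)))%:E)%E.
  by move=> a0; rewrite lee_fin mulr_ge0 ?expR_ge0.
have -> : mgf n k.+1 lam = (\int[P]_w (g (sample w) + g (flip k (sample w))))%E.
  rewrite (ge0_integralD P measurableT (fun w _ => g0 _) mgs (fun w _ => g0 _) mgf').
  rewrite flipE -(ge0_integralD P measurableT (fun w _ => g0 _) mgs (fun w _ => g0 _) mgs).
  by apply: eq_integral => w _; rewrite /g -EFinD; congr (_%:E); field.
have -> : ((expR (2 * (lam * b) ^+ 2))%:E * mgf n k lam =
    \int[P]_w (expR (2 * (lam * b) ^+ 2) *
      expR (lam * smooth_sum n k (sample w)))%:E)%E.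
  exact: esym (ge0_integralZl_EFin P measurableT (@expE_ge0 n k lam)
    (@mexpE n k lam) (expR_ge0 _)).
apply: (ae_ge0_le_integral measurableT).
- by move=> w _; apply: adde_ge0; exact: g0.
- exact: emeasurable_funD.
- by move=> w _; apply: e0; exact: expR_ge0.
- exact: mexpM.
apply: filterS layer_le => w le_b _.
by rewrite gfE /g -EFinD lee_fin smooth_sumS; exact: cosh_step.
Qed.

(** Iterating [mgf_step], each layer adds [2 (lam b_i)^2] to the exponent. The initial [lam] comes
    from the term [l = 1], the only one left in [smooth_sum n 0]. *)
Lemma mgf_le n k (lam : R) (b : nat -> R) : (0 < n)%N -> (k <= n.+1)%N ->
  (forall i, (i <= n)%N -> {ae P, forall w, `|layer_sum n i (sample w)| <= b i}) ->
  (mgf n k lam <= (expR (lam + 2 * lam ^+ 2 * \sum_(i < k) b i ^+ 2))%:E)%E.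
Proof.
move=> n0 + layer_le; elim: k => [_|k IH kn].
  rewrite /mgf big_ord0 mulr0 addr0.
  under eq_integral do rewrite smooth_sum0// mulr1.
  rewrite integral_cst// [X in (_ * X)%E](_ : _ = 1%E) ?mule1//.
  exact: probability_setT.
apply: (le_trans (mgf_step lam (layer_le k kn))).
have := lee_wpmul2l _ (IH (ltnW kn)).
move=> /(_ (expR (2 * (lam * b k) ^+ 2))%:E); rewrite lee_fin expR_ge0.
move=> /(_ isT) /le_trans; apply.
rewrite -EFinM lee_fin -expRD ler_expR big_ord_recr/= exprMn.
by rewrite le_eqVlt; apply/orP; left; apply/eqP; ring.
Qed.

Lemma Lnorm_smooth_sum_le n (q B : R) (b : nat -> R) : (0 < n)%N -> 2 <= q ->
  1 <= B -> \sum_(i < n.+1) b i ^+ 2 <= B ^+ 2 ->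
  (forall i, (i <= n)%N -> {ae P, forall w, `|layer_sum n i (sample w)| <= b i}) ->
  ('N[P]_(q%:E)[EFin \o (fun w => smooth_sum n n.+1 (sample w))]
    <= (2 * expR 2 * Num.sqrt q * B)%:E)%E.
Proof.
move=> n0 q2 B1 bB layer_le.
have q0 : 0 < q by lra.
have B0 : 0 < B by lra.
have s0 : 0 < Num.sqrt q by rewrite sqrtr_gt0.
have sq : Num.sqrt q ^+ 2 = q by rewrite sqr_sqrtr// ltW.
(* With this choice [lam^2 B^2 = q], and [B >= 1] gives [lam <= q], so the exponent in [mgf_le] is
   at most [3 q] for both signs of [lam]. *)
pose lam := Num.sqrt q / B.
have l0 : 0 < lam by rewrite divr_gt0.
have lB : lam * B = Num.sqrt q by rewrite divfK ?lt0r_neq0.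
have lq : lam <= q.
  have l1 : lam <= Num.sqrt q by rewrite -lB ler_peMr// ltW.
  have s1 : 1 <= Num.sqrt q by rewrite -[leLHS]sqrtr1 ler_wsqrtr//; lra.
  by rewrite (le_trans l1)// -[leRHS]sq ler_eXnr.
pose A := (q / (expR 1 * lam)) `^ q.
have A0 : 0 <= A by exact: powR_ge0.
have mgf_bound (mu : R) : `|mu| = lam -> (mgf n n.+1 mu <= (expR (3 * q))%:E)%E.
  move=> mul; apply: (le_trans (mgf_le _ n0 (leqnn _) layer_le)).
  rewrite lee_fin ler_expR -real_normK ?num_real// mul.
  have := ler_norm mu; have := sqr_ge0 lam; rewrite mul.
  have : lam ^+ 2 * B ^+ 2 = q by rewrite -exprMn lB.
  have := ler_wpM2l (sqr_ge0 lam) bB; lra.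
have int_le : (\int[P]_w (`|smooth_sum n n.+1 (sample w)| `^ q)%:E <=
    (A * (2 * expR (3 * q)))%:E)%E.
  apply: (@le_trans _ _ (\int[P]_w (A * expR (lam * smooth_sum n n.+1 (sample w)) +
      A * expR (- lam * smooth_sum n n.+1 (sample w)))%:E)%E).
    apply: (ge0_le_integral P measurableT).
    - by move=> w _; rewrite lee_fin powR_ge0.
    - apply/measurable_EFinP; apply: (measurableT_comp (measurable_powR q)).
      apply: measurableT_comp; first exact: normr_measurable.
      exact: measurable_smooth_sum_sample.
    - apply/measurable_EFinP.
      by apply: measurable_funD; apply/measurable_EFinP; exact: mexpM.
    - by move=> w _; rewrite lee_fin -mulrDr powR_le_expR.
  have half (mu : R) : `|mu| = lam ->
      (\int[P]_w (A * expR (mu * smooth_sum n n.+1 (sample w)))%:E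
      <= (A * expR (3 * q))%:E)%E.
    move=> mul; under eq_integral do rewrite EFinM.
    rewrite (ge0_integralZl_EFin P measurableT (@expE_ge0 n n.+1 mu)
      (@mexpE n n.+1 mu) A0).
    by rewrite EFinM; apply: lee_wpmul2l; rewrite ?lee_fin// mgf_bound.
  under eq_integral do rewrite EFinD.
  rewrite (ge0_integralD P measurableT _ (mexpM _ _ _ _) _ (mexpM _ _ _ _)); last 2 first.
  - by move=> w _; rewrite lee_fin mulr_ge0 ?expR_ge0.
  - by move=> w _; rewrite lee_fin mulr_ge0 ?expR_ge0.
  have -> : A * (2 * expR (3 * q)) = A * expR (3 * q) + A * expR (3 * q) by ring.
  by rewrite EFinD leeD// half// ?normrN gtr0_norm.
(* Here [A = (sqrt q * B / e)^q], and [2 e^(3 q) <= (2 e^3)^q]; the product of the two bases is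
   [2 e^2 sqrt q B]. *)
have A_le : A * (2 * expR (3 * q)) <= (2 * expR 2 * Num.sqrt q * B) `^ q.
  have -> : A = (Num.sqrt q * B / expR 1) `^ q.
    congr (_ `^ _); rewrite /lam -{1}sq.
    by field; rewrite !lt0r_neq0 ?expR_gt0.
  have -> : 2 * expR 2 * Num.sqrt q * B = Num.sqrt q * B / expR 1 * (2 * expR 3).
    have -> : expR 3 = expR 2 * expR 1 :> R by rewrite -expRD; congr expR; ring.
    by field; rewrite lt0r_neq0 ?expR_gt0.
  rewrite [leRHS]powRM; last 2 first.
  - by rewrite divr_ge0 ?expR_ge0// mulr_ge0// ltW.
  - by rewrite mulr_ge0 ?expR_ge0.
  rewrite ler_wpM2l ?powR_ge0// powRM ?expR_ge0// -expRM ler_wpM2r ?expR_ge0//.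
  by rewrite le1r_powR//; lra.
have r0 : 0 <= 2 * expR 2 * Num.sqrt q * B.
  by rewrite !mulr_ge0 ?expR_ge0// ltW.
have rE : 2 * expR 2 * Num.sqrt q * B =
    (2 * expR 2 * Num.sqrt q * B) `^ q `^ q^-1.
  by rewrite -powRrM mulfV ?lt0r_neq0// powRr1.
rewrite unlock rE -poweR_EFin; apply: gt0_ler_poweR.
- by rewrite invr_ge0 ltW.
- by rewrite in_itv/= leey andbT integral_ge0// => w _; exact: poweR_ge0.
- by rewrite in_itv/= leey andbT lee_fin powR_ge0.
apply: (@le_trans _ _ (A * (2 * expR (3 * q)))%:E); last by rewrite lee_fin.
apply: le_trans int_le; rewrite le_eqVlt; apply/orP; left; apply/eqP.
by apply: eq_integral.
Qed.

End moments.

(** * Growth of the bound on [omega], and a tail sum *)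

Section omega_estimates.
Context {R : realType}.
Implicit Types (x y c : R) (n N l : nat).

(** Concavity gives [ln y <= ln x + (y / x - 1)], and [ln x >= 1] turns this into
    [ln y <= ln x * (y / x)]. *)
Lemma ler_div_ln x y : 1 <= ln x -> x <= y -> x / ln x <= y / ln y.
Proof.
move=> lx1 xy.
have x0 : 0 < x.
  by rewrite ltNge; apply/negP => x0; move: lx1; rewrite ln0// ler10.
have y0 : 0 < y by exact: lt_le_trans xy.
have lxy : ln x <= ln y by rewrite ler_ln ?posrE.
have h : ln y <= ln x + (y / x - 1).
  rewrite -lerBlDl -ln_div ?posrE// -{1}(subrK 1 (y / x)) addrC le_ln1Dx//.
  by have := divr_gt0 y0 x0; lra.
have h2 : ln y <= ln x * (y / x).
  have : 1 <= y / x by rewrite ler_pdivlMr// mul1r.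
  by move: h; nra.
rewrite ler_pdivrMr; last lra.
rewrite mulrAC ler_pdivlMr; last lra.
have := ler_wpM2l (ltW x0) h2; congr (_ <= _).
by field; rewrite lt0r_neq0.
Qed.

(** Since [ln x = 2 ln (sqrt x)], this is [ln z < z] at [z = sqrt x]. *)
Lemma sqrt_le_div_ln x : 0 < ln x -> Num.sqrt x / 2 <= x / ln x.
Proof.
move=> lx; have x0 : 0 < x.
  by rewrite ltNge; apply/negP => x0; move: lx; rewrite ln0// ltxx.
have s0 : 0 < Num.sqrt x by rewrite sqrtr_gt0.
have sE : Num.sqrt x ^+ 2 = x by rewrite sqr_sqrtr// ltW.
have lE : ln x = 2 * ln (Num.sqrt x) by rewrite -{1}sE lnXn// mulr_natl.
have := ler_wpM2l (ltW s0) (ltW (ln_sublinear s0)).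
by rewrite ler_pdivlMr// lE -expr2 sE; lra.
Qed.

Lemma ln_nat_ge x : exists n0, forall n, (n0 <= n)%N -> x <= ln (n%:R : R).
Proof.
exists (Num.truncn (expR x)).+1 => n hn.
have n0 : 0 < n%:R :> R by rewrite ltr0n (leq_ltn_trans _ hn).
rewrite -(expRK x) ler_ln ?posrE ?expR_gt0//.
by rewrite (le_trans (ltW (truncnS_gt _)))// ler_nat.
Qed.

Lemma lnln_nat_ge x : exists n0, forall n, (n0 <= n)%N -> x <= ln (ln (n%:R : R)).
Proof.
have [n0 h] := ln_nat_ge (expR x); exists n0 => n /h le_n.
by rewrite -{1}(expRK x) ler_ln ?posrE ?expR_gt0// (lt_le_trans (expR_gt0 _) le_n).
Qed.

Lemma omega_le l : (omega l <= l)%N.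
Proof.
have [->//|l0] := posnP l; rewrite -[leqRHS](size_iota 1).
apply: uniq_leq_size; first exact: primes_uniq.
move=> p; rewrite mem_primes mem_iota add1n ltnS => /and3P[pp _ pl].
by rewrite prime_gt0// dvdn_leq.
Qed.

Lemma omega_gt0 l : (1 < l)%N -> (0 < omega l)%N.
Proof.
move=> l1; have : pdiv l \in primes l.
  by rewrite mem_primes pdiv_prime// pdiv_dvd (ltn_trans _ l1).
by rewrite /omega; case: (primes l).
Qed.

Lemma omega_bound_gt0 c : omega_bound c -> 0 < c.
Proof.
move=> [L hL]; have [n1 h1] := lnln_nat_ge 1.
pose l := maxn 2 (maxn L n1).
have ll1 : 1 <= ln (ln (l%:R : R)) by apply: h1; rewrite !leq_max leqnn !orbT.
have l1 : 0 < ln (l%:R : R) by rewrite ln_gt0// ltr1n leq_max.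
have : (1 : R) <= (omega l)%:R by rewrite ler1n omega_gt0// leq_max.
move=> /le_trans/(_ (hL l _)); rewrite !leq_max leqnn !orbT => /(_ isT).
rewrite -mulrA => h; rewrite ltNge; apply/negP => c0.
have : 0 <= ln (l%:R : R) / ln (ln (l%:R : R)) by rewrite divr_ge0//; lra.
by move: h; nra.
Qed.

(** Large [l] are handled by monotonicity of [x / ln x] at [x = ln l]. Small [l] satisfy
    [omega l <= l], a bounded quantity, while the right-hand side tends to infinity with [n]. *)
Lemma omega_bound_upto c : omega_bound c ->
  exists n0, forall n, (n0 <= n)%N -> forall l, (0 < l <= n)%N ->
    (omega l)%:R <= c * ln n%:R / ln (ln n%:R).
Proof.
move=> hc; have c0 := omega_bound_gt0 hc; case: hc => L hL.
have [n1 h1] := lnln_nat_ge 1; have [n2 h2] := ln_nat_ge 1.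
pose L' := maxn L (maxn n1 n2).
(* From here on [c * sqrt (ln n) / 2 >= L'], which covers every [l < L']. *)
have [n3 h3] := ln_nat_ge ((2 * L'%:R / c) ^+ 2).
exists (maxn L' n3) => n; rewrite !geq_max => /andP[/and3P[_ nn1 nn2] nn3].
move=> l /andP[l0 le_ln]; rewrite -mulrA.
have [L'l|lL'] := leqP L' l.
  apply: (le_trans (hL l _)); first by rewrite (leq_trans _ L'l)// leq_maxl.
  rewrite -mulrA ler_pM2l// ler_div_ln//.
    by apply: h1; rewrite (leq_trans _ L'l)// !leq_max leqnn !orbT.
  by rewrite ler_ln ?posrE ?ltr0n ?ler_nat// (leq_trans l0).
have lln : 0 < ln (ln (n%:R : R)) by have := h1 n nn1; lra.
have := ler_wpM2l (ltW c0) (sqrt_le_div_ln lln); apply: le_trans.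
have : Num.sqrt ((2 * L'%:R / c) ^+ 2) <= Num.sqrt (ln n%:R) :> R.
  by rewrite ler_wsqrtr// h3.
rewrite sqrtr_sqr ger0_norm; last by rewrite !divr_ge0// ltW.
rewrite ler_pdivrMr// => h.
have : (omega l)%:R <= L'%:R :> R by rewrite ler_nat (leq_trans (omega_le l))// ltnW.
by lra.
Qed.

(** Telescoping, by [1 / (a + 1)^2 <= 1 / a - 1 / (a + 1)]. *)
Lemma sum_inv_sqr_le N m : (0 < N)%N ->
  \sum_(N.+1 <= k < (N + m).+1) (k%:R ^- 2 : R) <= N%:R^-1 - (N + m)%:R^-1.
Proof.
move=> N0; elim: m => [|m IH]; first by rewrite addn0 big_geq// subrr.
rewrite addnS big_nat_recr/= ?ltnS ?leq_addr//.
have a0 : 0 < (N + m)%:R :> R by rewrite ltr0n addn_gt0 N0.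
have h : (N + m).+1%:R ^- 2 <= (N + m)%:R^-1 - (N + m).+1%:R^-1 :> R.
  rewrite -natr1; set a := (N + m)%:R : R in a0 *.
  have -> : a^-1 - (a + 1)^-1 = (a * (a + 1))^-1.
    by field; rewrite lt0r_neq0//= lt0r_neq0//; lra.
  by rewrite lef_pV2 ?posrE; nra.
by apply: (le_trans (lerD IH h)); rewrite addrA subrK.
Qed.

End omega_estimates.

(** * The sum of the squared layer counts *)

Section layer_counts.
Context {R : realType}.
Implicit Types (c s : R) (n N : nat).

Lemma prod1D_le_expR N (a : nat -> R) : (forall i, 0 <= a i) ->
  \prod_(i < N) (1 + a i) <= expR (\sum_(i < N) a i).
Proof.
move=> a0; rewrite expR_sum; apply: ler_prod => i _.
by rewrite expR_ge1Dx andbT addr_ge0.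
Qed.

(* Rankin's bound with [sigma = 1 - 2 / s], for which
   [p ^ - sigma <= e ^ 2 / p] when [p <= e ^ s]. *)
Lemma smooth_count_le n N s : 2 <= s -> ln n%:R = s ^+ 2 ->
  (0 < N)%N -> ln N%:R <= s -> (0 < n)%N ->
  expR 2 * \sum_(p < N.+1) (prime p)%:R / p%:R <= s ->
  (smooth_count n N.+1)%:R <= expR (s ^+ 2 - s).
Proof.
move=> s2 lnn N0 lnN n0 sum_le.
have s0 : 0 < s by lra.
have sg0 : 0 <= 1 - 2 / s by rewrite subr_ge0 ler_pdivrMr// mul1r.
apply: (le_trans (smooth_count_rankin n N.+1 sg0)).
(* The first factor is [n ^ sigma], as [n = e^(s^2)]; the second will bound the Euler product. *)
have -> : expR (s ^+ 2 - s) = expR (s ^+ 2 - 2 * s) * expR s.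
  by rewrite -expRD; congr expR; ring.
apply: ler_pM; rewrite ?powR_ge0//.
- by apply: prodr_ge0 => i _; rewrite addr_ge0// mulr_ge0 ?powR_ge0.
- rewrite /powR gt_eqF ?ltr0n// lnn ler_expR le_eqVlt; apply/orP; left; apply/eqP.
  by field; rewrite lt0r_neq0.
apply: (le_trans (prod1D_le_expR (a := fun i =>
    (prime i)%:R * i%:R `^ (- (1 - 2 / s))) _ _)).
  by move=> i; rewrite mulr_ge0 ?powR_ge0.
rewrite ler_expR (le_trans _ sum_le)// mulr_sumr; apply: ler_sum => i _.
case: (boolP (prime i)) => [pi|_]; last by rewrite !mul0r mulr0.
have i0 : 0 < i%:R :> R by rewrite ltr0n prime_gt0.
rewrite mul1r div1r /powR gt_eqF//.
have -> : - (1 - 2 / s) * ln i%:R = 2 / s * ln i%:R - ln i%:R by ring.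
rewrite expRB lnK ?posrE// ler_pM2r ?invr_gt0// ler_expR.
rewrite mulrAC ler_pdivrMr// ler_pM2l// (le_trans _ lnN)//.
rewrite ler_ln ?posrE ?i0 ?ltr0n//.
by rewrite ler_nat -ltnS ltn_ord.
Qed.

(** Split at [N], where [N <= e^s < N + 1 <= 2 N]. The layers up to [N] contribute at most
    [(N + 1) e^(2 s^2 - 2 s)], the others at most [n^2 / N]; each is at most [2 e^(2 s^2 - s)]. *)
Lemma sum_layer_count_sqr_le n s : 2 <= s -> ln n%:R = s ^+ 2 -> (0 < n)%N ->
  let N := Num.truncn (expR s) in
  expR 2 * \sum_(p < N.+1) (prime p)%:R / p%:R <= s ->
  \sum_(k < n.+1) (layer_count n k)%:R ^+ 2 <= 4 * expR (2 * s ^+ 2 - s).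
Proof.
move=> s2 lnn n0 N sum_le.
have nE : n%:R = expR (s ^+ 2) by rewrite -lnn lnK// posrE ltr0n.
have e2 : 2 <= expR s by have := expR_ge1Dx s; lra.
have NE : N%:R <= expR s < N.+1%:R by rewrite truncn_itv// expR_ge0.
have /andP[N1 N2] := NE; rewrite -natr1 in N2.
have Nhalf : expR s <= 2 * N%:R.
  have : (1 <= N)%N by rewrite -ltnS -(ltr_nat R) -natr1; lra.
  by rewrite -(ler1n R); lra.
have N0 : (0 < N)%N by rewrite -(ltr0n R); lra.
have Nn : (N <= n)%N by rewrite -(ler_nat R) nE (le_trans N1)// ler_expR; nra.
have lnN : ln N%:R <= s by rewrite -(expRK s) ler_ln ?posrE ?expR_gt0 ?ltr0n.
rewrite -(big_mkord predT (fun k => (layer_count n k)%:R ^+ 2)).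
rewrite (big_cat_nat (n := N.+1))//=.
have -> : 4 * expR (2 * s ^+ 2 - s) =
  2 * expR (2 * s ^+ 2 - s) + 2 * expR (2 * s ^+ 2 - s) by ring.
apply: lerD.
  apply: (@le_trans _ _ (\sum_(0 <= k < N.+1) expR (s ^+ 2 - s) ^+ 2)).
    rewrite big_nat_cond [leRHS]big_nat_cond; apply: ler_sum => k /andP[/andP[_ kN] _].
    rewrite lerXn2r ?nnegrE ?expR_ge0//.
    apply: le_trans (smooth_count_le s2 lnn N0 lnN n0 sum_le).
    by rewrite ler_nat layer_count_le_smooth.
  rewrite big_const_nat iter_addr_0 subn0 -[leLHS]mulr_natl -expRM_natl.
  have -> : 2 * (s ^+ 2 - s) = (2 * s ^+ 2 - s) - s by ring.
  move: (2 * s ^+ 2 - s) => E.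
  rewrite expRB mulrA ler_pdivrMr ?expR_gt0// mulrAC ler_wpM2r ?expR_ge0//.
  rewrite -natr1; have : 1 <= N%:R :> R by rewrite ler1n.
  lra.
apply: (@le_trans _ _ (n%:R ^+ 2 * \sum_(N.+1 <= k < n.+1) (k%:R ^- 2))).
  rewrite mulr_sumr big_nat_cond [leRHS]big_nat_cond.
  apply: ler_sum => k /andP[/andP[Nk _] _].
  have k0 : 0 < k%:R :> R by rewrite ltr0n (leq_ltn_trans _ Nk).
  rewrite -expr_div_n lerXn2r ?nnegrE ?divr_ge0//.
  rewrite ler_pdivlMr// -natrM ler_nat (leq_trans _ (leq_trunc_div n k))//.
  by rewrite leq_mul2r layer_count_le_div orbT.
have := @sum_inv_sqr_le R N (n - N) N0; rewrite subnKC// => h.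
have {}h : \sum_(N.+1 <= k < n.+1) (k%:R ^- 2) <= N%:R^-1 :> R.
  by rewrite (le_trans h)// gerBl invr_ge0.
apply: (le_trans (ler_wpM2l (sqr_ge0 _) h)).
rewrite nE -expRM_natl expRB mulrA ler_pdivrMr ?ltr0n// mulrAC.
by rewrite ler_pdivlMr ?expR_gt0// mulrAC mulrC ler_wpM2r ?expR_ge0// mulrC.
Qed.

Lemma sum_layer_count_sqr_eventually c : omega_bound c ->
  exists n0, forall n, (n0 <= n)%N ->
  \sum_(k < n.+1) (layer_count n k)%:R ^+ 2 <=
  (2 * n%:R `^ (1 - (2 * (1 + Num.sqrt (ln n%:R)))^-1)) ^+ 2 :> R.
Proof.
move=> hc; have c0 := omega_bound_gt0 hc.
have [n1 h1] := omega_bound_upto hc.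
have [n2 h2] := lnln_nat_ge (2 * c * expR 2).
(* Chosen so that [s >= m] forces both [s >= 2] and, through [N + 1 > e^s >= 1 + s], that [N]
   exceeds [n1] and [n2]. *)
pose m : R := 2 + n1%:R + n2%:R.
have m0 : 0 <= m by rewrite !addr_ge0.
have [n3 h3] := ln_nat_ge (m ^+ 2).
exists (maxn 1 n3) => n; rewrite geq_max => /andP[n0 nn3].
set s := Num.sqrt (ln n%:R).
have sm : m <= s.
  by rewrite -[leLHS]ger0_norm// -sqrtr_sqr ler_wsqrtr// h3.
have s2 : 2 <= s by rewrite (le_trans _ sm)// /m -addrA lerDl addr_ge0.
have s0 : 0 < s by lra.
have lnn : ln n%:R = s ^+ 2.
  by rewrite sqr_sqrtr// (le_trans _ (h3 n nn3))// sqr_ge0.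
pose N := Num.truncn (expR s).
have NE : N%:R <= expR s < N.+1%:R by rewrite truncn_itv// expR_ge0.
have /andP[N1 N2] := NE; rewrite -natr1 in N2.
have Nm : 1 + n1%:R + n2%:R <= N%:R :> R.
  have := expR_ge1Dx s; move: sm; rewrite /m; lra.
have Nn1 : (n1 <= N)%N.
  by rewrite -(ler_nat R) (le_trans _ Nm)// addrAC lerDr addr_ge0.
have Nn2 : (n2 <= N)%N by rewrite -(ler_nat R) (le_trans _ Nm)// lerDr addr_ge0.
have N0 : (0 < N)%N by rewrite -(ler1n R) (le_trans _ Nm)// -addrA lerDl addr_ge0.
have lnN : ln N%:R <= s by rewrite -(expRK s) ler_ln ?posrE ?expR_gt0 ?ltr0n.
have lnN0 : 0 <= ln N%:R :> R by rewrite ln_ge0// ler1n.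
(* The sum is at most [2 c ln N / ln (ln N)], and [n2] was chosen to give [ln (ln N) >= 2 c e^2]. *)
have sum_le : expR 2 * \sum_(p < N.+1) (prime p)%:R / p%:R <= s.
  apply: (le_trans _ lnN).
  have := ler_wpM2l (expR_ge0 (2 : R)) (sum_inv_primes_le N0 (h1 N Nn1)).
  move=> /le_trans; apply; have lln := h2 N Nn2.
  have lln0 : 0 < ln (ln N%:R) :> R.
    by rewrite (lt_le_trans _ lln)// !mulr_gt0 ?expR_gt0.
  rewrite !mulrA ler_pdivrMr// mulrC [leRHS]mulrC.
  have := ler_wpM2r lnN0 lln; lra.
apply: (le_trans (sum_layer_count_sqr_le s2 lnn n0 sum_le)).
rewrite exprMn -natrX ler_wpM2l// /powR gt_eqF ?ltr0n// -expRM_natl ler_expR lnn.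
(* The loss in the exponent is harmless: [s^2 / (1 + s) <= s]. *)
have -> : 2%:R * ((1 - (2 * (1 + s))^-1) * s ^+ 2) = 2 * s ^+ 2 - s ^+ 2 / (1 + s).
  by field; rewrite lt0r_neq0//; lra.
rewrite lerD2l lerN2 ler_pdivrMr; last lra.
by nra.
Qed.

End layer_counts.

(** * Application to the random partial sums *)

Section random_multiplicative_sums.
Context {R : realType} d (T : measurableType d) (P : probability T R)
  (X : nat -> {RV P >-> R}).

Lemma partial_sumE n w : partial_sum X n w = smooth_sum n n.+1 (sample X w).
Proof. by rewrite smooth_sum_top. Qed.

(** There are countably many primes, so one null set serves for all of them. *)
Lemma ae_sample_le (M : R) : sup_Linfty X = M%:E ->
  {ae P, forall w p, prime p -> `|sample X w p| <= M}.
Proof.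
move=> supM; apply: ae_foralln => p.
have [pp|npp] := boolP (prime p); last by apply: aeW => w.
have Xp : ('N[P]_+oo[EFin \o X p] <= M%:E)%E.
  by rewrite -supM; apply: ereal_sup_ubound; exists p.
(* The L^oo norm unfolds to an essential supremum only when the space has positive measure. *)
have P0 : (0 < P setT)%E by rewrite probability_setT lte01.
move: Xp; rewrite unlock ifT; last exact: P0.
move=> /ess_supP.
by apply: filterS => w /=; rewrite lee_fin.
Qed.

Lemma ae_layer_sum_le n k (M m A : R) : sup_Linfty X = M%:E -> M <= m ->
  (forall l, (0 < l <= n)%N -> m ^+ omega l <= A) ->
  {ae P, forall w, `|layer_sum n k (sample X w)| <= A * (layer_count n k)%:R}.
Proof.
move=> /ae_sample_le XM Mm mA; apply: filterS XM => w XM.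
by apply: norm_layer_sum mA => p pp; rewrite (le_trans (XM p pp)).
Qed.

Hypothesis indX : prime_independent X.
Hypothesis symX : forall p, prime p -> symmetric_rv (X p).

(** The parameters [A] and [t] are left free because the bound serves twice: with sharp values for
    large [n], with crude ones for the remaining [n]. *)
Lemma Lnorm_partial_sum_le n (q M m A t : R) : (0 < n)%N -> 2 <= q ->
  sup_Linfty X = M%:E -> M <= m ->
  (forall l, (0 < l <= n)%N -> m ^+ omega l <= A) ->
  0 <= A -> \sum_(k < n.+1) (layer_count n k)%:R ^+ 2 <= t ^+ 2 -> 1 <= A * t ->
  ('N[P]_(q%:E)[EFin \o partial_sum X n] <=
    (2 * expR 2 * Num.sqrt q * (A * t))%:E)%E.
Proof.
move=> n0 q2 supM Mm mA A0 count_le At.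
have -> : partial_sum X n = fun w => smooth_sum n n.+1 (sample X w).
  by apply/funext => w; exact: partial_sumE.
apply: (Lnorm_smooth_sum_le indX symX n0 q2 At
  (b := fun k => A * (layer_count n k)%:R)).
  under eq_bigr do rewrite exprMn.
  by rewrite -mulr_sumr exprMn ler_wpM2l ?sqr_ge0.
by move=> k _; exact: ae_layer_sum_le supM Mm mA.
Qed.

End random_multiplicative_sums.

(** The sum is at most [(n + 1)^3]; the bound is weakened to a square to fit the form [t ^+ 2]. *)
Lemma sum_layer_count_sqr_trivial (R : realType) n :
  \sum_(k < n.+1) (layer_count n k)%:R ^+ 2 <= (n.+1%:R ^+ 2) ^+ 2 :> R.
Proof.
apply: (@le_trans _ _ (\sum_(k < n.+1) n.+1%:R ^+ 2)).
  apply: ler_sum => k _; rewrite lerXn2r ?nnegrE// ler_nat.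
  by rewrite (leq_trans (layer_count_le_div n k))// leqW// leq_div.
rewrite sumr_const card_ord -[leLHS]mulr_natl -exprM -exprS.
by rewrite ler_weXn2l// ler1n.
Qed.

Unset Implicit Arguments.

Theorem theorem2p6 (R : realType) (RH : riemann_hypothesis R) :
  exists C : R, 0 < C /\
  forall c : R, omega_bound c ->
  exists n0 : nat, forall M : R,
  exists K : R, 0 < K /\
  forall (d : measure_display) (T : measurableType d) (P : probability T R)
    (X : nat -> {RV P >-> R}),
    prime_independent X ->
    (forall p, prime p -> symmetric_rv (X p)) ->
    (forall p, prime p -> nonconstant_rv (X p)) ->
    sup_Linfty X = M%:E ->
  forall (q : R) (n : nat), 2 <= q -> (3 <= n)%N ->
    ('N[P]_(q%:E)[EFin \o partial_sum X n] <=
      ((if (n0 <= n)%N then C else K) * Num.sqrt q * Mseq M c n *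
       n%:R `^ (1 - (2 * (1 + Num.sqrt (ln n%:R)))^-1))%:E)%E.
Proof.
(* The moment bound gives [2 e^2], the layer counts another factor 2. *)
exists (4 * expR 2); split; first by rewrite mulr_gt0 ?expR_gt0.
move=> c hc.
have [n1 omega_le_n] := omega_bound_upto hc.
have [n2 count_le] := sum_layer_count_sqr_eventually hc.
(* This makes the exponent in [Mseq] nonnegative, hence [Mseq M c n >= 1]. *)
have [n3 lnln_ge] := lnln_nat_ge (0 : R).
exists (maxn n1 (maxn n2 n3)) => M.
pose m := Num.max M 1.
have Mm : M <= m by rewrite le_max lexx.
have m1 : 1 <= m by rewrite le_max lexx orbT.
have m0 : 0 < m by lra.
pose t n : R := n%:R `^ (1 - (2 * (1 + Num.sqrt (ln n%:R)))^-1).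
have Mseq0 n : 0 < Mseq M c n by exact: powR_gt0.
have t0 n : (0 < n)%N -> 0 < t n by move=> n0; rewrite powR_gt0// ltr0n.
(* The ratio of the crude bound to the target at [n], apart from [sqrt q]. It depends only on [M],
   [c] and [n], so the sum over [n < n0] gives a [K] chosen before the probability space. *)
pose crude n : R := 2 * expR 2 * (m ^+ n * n.+1%:R ^+ 2) / (Mseq M c n * t n).
have crude0 n : 0 <= crude n.
  rewrite divr_ge0 ?mulr_ge0 ?expR_ge0 ?powR_ge0//; exact: exprn_ge0 (ltW m0).
set n0 := maxn _ _.
exists (1 + \sum_(i < n0) crude i); split.
  by rewrite ltr_pwDl// sumr_ge0.
move=> d T P X indX symX _ supM q n q2 n3'.
have n_gt0 : (0 < n)%N by exact: leq_trans n3'.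
rewrite -/(t n); case: leqP => [n0n|nn0].
  move: n0n; rewrite !geq_max => /and3P[nn1 nn2 nn3].
  have t1 : 1 <= t n.
    rewrite -[leLHS](powRr0 n%:R) ler_powR ?ler1n// subr_ge0 invf_le1.
      have := sqrtr_ge0 (ln n%:R : R); lra.
    have := sqrtr_ge0 (ln n%:R : R); lra.
  have c0 := omega_bound_gt0 hc.
  have M1 : 1 <= Mseq M c n.
    rewrite -[leLHS](powRr0 m) ler_powR// divr_ge0 ?lnln_ge// mulr_ge0 ?(ltW c0)//.
    by rewrite ln_ge0// ler1n.
  have := Lnorm_partial_sum_le indX symX n_gt0 q2 supM Mm _ (ltW (Mseq0 n))
    (count_le n nn2) _.
  move=> /(_ _ _)/le_trans; apply.
  - move=> l ln; rewrite -powR_mulrn ?(ltW m0)// ler_powR//.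
    exact: omega_le_n.
  - by rewrite -/(t n); nra.
  - by rewrite lee_fin -/(t n) le_eqVlt; apply/orP; left; apply/eqP; ring.
have A0 : 0 <= m ^+ n by exact: exprn_ge0 (ltW m0).
have := Lnorm_partial_sum_le indX symX n_gt0 q2 supM Mm _ A0
  (sum_layer_count_sqr_trivial R n) _.
move=> /(_ _ _)/le_trans; apply.
- move=> l /andP[_ ln]; rewrite ler_weXn2l//.
  exact: leq_trans (omega_le l) ln.
- by rewrite mulr_ege1// exprn_ege1// ler1n.
have crude_le : crude n <= 1 + \sum_(i < n0) crude i.
  rewrite (bigD1 (Ordinal nn0))//= addrCA lerDl addr_ge0// sumr_ge0//.
have Mt0 : 0 < Mseq M c n * t n by rewrite mulr_gt0// t0.
move: crude_le; rewrite ler_pdivrMr// => /(ler_wpM2l (sqrtr_ge0 q)) h.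
rewrite lee_fin; move: h; set S := 1 + _; congr (_ <= _); ring.
Qed.
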